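(* Let $a=(a_i)_{i\in\mathbb Z}$ be a sequence of pairwise distinct complex numbers. Let $f\in\Lambda$ have degree $\le n$ and write $f=\sum_{\lambda:\,|\lambda|\le n}c(\lambda)s_{\lambda;a}$. Then the coefficients are determined recursively in $|\lambda|$ by $c(\varnothing)=f(0;0)$ and $$c(\lambda)=\frac{f(x(\lambda);y(\lambda))-\sum_{\mu\subset\lambda,\ \mu\ne\lambda}c(\mu)\,s_{\mu;a}(x(\lambda);y(\lambda))}{s_{\lambda;a}(x(\lambda);y(\lambda))}.$$
   Context: $\Lambda$ is the algebra of symmetric functions over $\mathbb C$ (graded by degree) with complete homogeneous $h_k$, elementary $e_k$, power sums $\mathbf p_k$. For a sequence $a$ define $h_{k;a}=\sum_{i=1}^k(-1)^{k-i}e_{k-i}(a_1,\dots,a_{k-1})h_i$ ($k\ge1$), $h_{0;a}=1$, $h_{k;a}=0$ ($k<0$); $(\tau^ra)_i=a_{i+r}$; $s_{\mu;a}=\det[h_{\mu_i-i+j;\,\tau^{1-j}a}]_{i,j=1}^N$ for any $N\ge\ell(\mu)$; $s_{\mu;a}$ equals the Schur function $s_\mu$ plus lower-degree terms, and these functions form a basis of $\Lambda$. Dual sequence: $\widehat a_i=-a_{1-i}$. Each $f\in\Lambda$ is evaluated at $(x;y)\in\mathbb C^d\times\mathbb C^d$ via $\mathbf p_k\mapsto\sum_ix_i^k+(-1)^{k-1}\sum_jy_j^k$. For a nonempty diagram $\lambda=(p_1,\dots,p_d\mid q_1,\dots,q_d)$ in Frobenius notation ($p_i=\lambda_i-i$,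 $q_i=\lambda'_i-i$, $d$ the number of diagonal boxes), $(x(\lambda);y(\lambda))=(a_{p_1+1},\dots,a_{p_d+1};\widehat a_{q_1+1},\dots,\widehat a_{q_d+1})$; and $(x(\varnothing);y(\varnothing))=(0;0)$. *)

(* Defs.v *)
From HB Require Import structures.
From mathcomp Require Import all_boot all_order all_algebra.
From mathcomp Require Import mpoly.
Set Implicit Arguments. Unset Strict Implicit. Unset Printing Implicit Defensive.
Import Order.TTheory GRing.Theory Num.Theory.
Local Open Scope ring_scope.

(* Model of Lambda: Lambda is the polynomial algebra C[p_1, p_2, ...] in the
   power sums.  We work in the subalgebra Lam C N = C[p_1, ..., p_N]
   (variable i : 'I_N stands for p_(i+1)), which contains every symmetric
   function of degree <= N.  Degree is the usual grading (deg p_k = k). *)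
Definition Lam (C : numClosedFieldType) (N : nat) := {mpoly C[N]}.

Section SymFun.
Variables (C : numClosedFieldType) (N : nat).

(* power sum p_k (k >= 1); p_k for k > N is not in the model and is set to 0;
   it is only ever used with k <= N below *)
Definition psum (k : nat) : Lam C N :=
  match k with
  | 0 => 0
  | k'.+1 => match @insub nat (fun j => (j < N)%N) _ k' with
             | Some i => 'X_i
             | None => 0
             end
  end.

Definition mweight (m : 'X_{1..N}) : nat := (\sum_(i < N) i.+1 * m i)%N.

Definition deg_le (n : nat) (f : Lam C N) : bool :=
  all (fun m => mweight m <= n)%N (msupp f).

(* complete homogeneous h_0, ..., h_k via Newton's identities
   k h_k = sum_{i=1}^k p_i h_{k-i}  (correct for k <= N) *)
Fixpoint hlist (k : nat) : seq (Lam C N) :=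
  match k with
  | 0 => [:: 1]
  | k'.+1 => let l := hlist k' in
      rcons l ((k%:R)^-1 *: \sum_(i < k) psum i.+1 * nth 0 l (k' - i))
  end.

Definition hcomp (k : nat) : Lam C N := nth 0 (hlist k) k.

Definition elem (j : nat) (l : seq C) : C :=
  \sum_(s : {set 'I_(size l)} | #|s| == j) \prod_(i in s) nth 0 l i.

Definition hfa (k : int) (a : int -> C) : Lam C N :=
  match k with
  | Posz 0 => 1
  | Posz k'.+1 => \sum_(i < k'.+1)
       ((-1) ^+ (k' - i) * elem (k' - i) [seq a (j%:Z) | j <- iota 1 k'])
         *: hcomp i.+1
  | Negz _ => 0
  end.

Definition tau (r : int) (a : int -> C) : int -> C := fun i => a (i + r).

(* factorial Schur function s_{mu;a} = det [h_{mu_i - i + j; tau^{1-j} a}],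
   with N = l(mu) (0-based indices i, j below) *)
Definition sfa (a : int -> C) (mu : seq nat) : Lam C N :=
  \det (\matrix_(i < size mu, j < size mu)
          hfa ((nth 0%N mu i)%:Z - (i%:Z) + (j%:Z)) (tau (- (j%:Z)) a)).

Definition ev (f : Lam C N) (xs ys : seq C) : C :=
  f.@[fun i : 'I_N => \sum_(x <- xs) x ^+ i.+1
                      + (-1) ^+ i * \sum_(y <- ys) y ^+ i.+1].

End SymFun.

Definition is_part (lam : seq nat) : bool :=
  sorted geq lam && all (fun k => 0 < k)%N lam.

Notation psize lam := (sumn lam).

Definition subdiag (mu lam : seq nat) : bool :=
  all (fun i => nth 0 mu i <= nth 0 lam i)%N (iota 0 (size mu)).

(* conjugate partition lam'_(i+1) *)
Definition conjp (lam : seq nat) (i : nat) : nat := count (fun x => i < x)%N lam.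

Definition dlen (lam : seq nat) : nat :=
  size [seq i <- iota 0 (size lam) | (i < nth 0 lam i)%N].

Definition dual (C : numClosedFieldType) (a : int -> C) : int -> C :=
  fun i => - a (1 - i).

(* x(lam) = (a_{p_1+1}, ..., a_{p_d+1}) with p_i = lam_i - i (1-based) *)
Definition xlam (C : numClosedFieldType) (a : int -> C) (lam : seq nat) : seq C :=
  [seq a (((nth 0 lam i)%:Z - (i.+1)%:Z) + 1) | i <- iota 0 (dlen lam)].

(* y(lam) = (\hat a_{q_1+1}, ..., \hat a_{q_d+1}) with q_i = lam'_i - i *)
Definition ylam (C : numClosedFieldType) (a : int -> C) (lam : seq nat) : seq C :=
  [seq dual a (((conjp lam i)%:Z - (i.+1)%:Z) + 1) | i <- iota 0 (dlen lam)].

(* Enumeration of the partitions of size <= n: nonincreasing n-tuples with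
   entries in [0, n] and sum <= n, with the trailing zeros removed. *)
Definition part_tuple (n : nat) (t : n.-tuple 'I_n.+1) : bool :=
  sorted geq (map val t) && (sumn (map val t) <= n)%N.

Definition tpart (n : nat) (t : n.-tuple 'I_n.+1) : seq nat :=
  [seq k <- map val t | (0 < k)%N].

(* Main.v *)
Require Import Defs.
From HB Require Import structures.
From mathcomp Require Import all_boot all_order all_algebra.
From mathcomp Require Import mpoly.
From mathcomp Require Import zify ring.
Set Implicit Arguments. Unset Strict Implicit. Unset Printing Implicit Defensive.
Import Order.TTheory GRing.Theory Num.Theory.
Local Open Scope ring_scope.

(** The formula for [c lam] is the expansion of [f] evaluated at
    [(x(lam); y(lam))], once one knows that [s_{mu;a}] vanishes there unless
    [mu] is contained in [lam], and does not vanish for [mu = lam].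

    With 0-based rows and [M >= l(lam), l(mu)], the generating series of the
    [h_k] at this point is
    [H(u) = prod_(r < M) (u - a_{-r}) / (u - a_{lam_r - r})].
    Since [h_{k;a}] is the coefficient of [u^-1] in
    [(u - a_1)...(u - a_{k-1}) H(u)], the [(i, j)] entry of the determinant
    defining [s_{mu;a}] is the coefficient of [u^-1] in [A_i B_j / D], where
    [D] has the simple roots [a_{lam_r - r}], [A_i] is the product of the
    [u - a_m] for [1 - M <= m < mu_i - i], and [B_j] that for
    [1 - j <= m <= 0].  By Lagrange interpolation the matrix is
    [(A_i(x_r)) diag(1 / D'(x_r)) (B_j(x_r))^T].  If [mu_k > lam_k], the first
    [k + 1] rows of the left factor are supported on [k] columns; if
    [mu = lam] and [M = l(lam)], the left factor is triangular with nonzero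
    diagonal and the right one is essentially a Vandermonde matrix. *)

(** * Newton's identities for a ratio of polynomials *)

Definition newton_sum {R : comPzRingType} (p h : nat -> R) (k : nat) : R :=
  \sum_(i < k) p i.+1 * h (k.-1 - i)%N.

(** Convolution with [p] commutes with multiplying the series of [h] by [(1 - b t) / (1 - x t)],
    which is how [h'] arises from [h]. *)
Lemma newton_sum_pair (R : comPzRingType) (x b : R) (p h h' : nat -> R) :
  h' 0%N = h 0%N ->
  (forall k, h' k.+1 - x * h' k = h k.+1 - b * h k) ->
  forall k, newton_sum p h' k.+1 - x * newton_sum p h' k
            = newton_sum p h k.+1 - b * newton_sum p h k.
Proof.
move=> h'0 hS k; rewrite /newton_sum !big_ord_recr /= subnn h'0 !mulr_sumr.
rewrite addrAC [RHS]addrAC -!sumrB; congr (_ + _); apply: eq_bigr => i _.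
have -> : (k - i)%N = (k.-1 - i).+1 by have := ltn_ord i; lia.
by rewrite !(mulrCA _ (p _)) -!mulrBr hS.
Qed.

Lemma newton_sum_expr (R : comPzRingType) (x : R) (h : nat -> R) k :
  newton_sum (GRing.exp x) h k.+1
  = x * h k + x * newton_sum (GRing.exp x) h k.
Proof.
rewrite /newton_sum big_ord_recl expr1 subn0; congr (_ + _).
rewrite mulr_sumr; apply: eq_bigr => i _ /=.
by rewrite exprS mulrA; congr (_ * h _); rewrite /bump; lia.
Qed.

(** Logarithmic derivative: the factor [(1 - b t) / (1 - x t)] adds [x^i - b^i] to the power
    sums. *)
Lemma newton_pair (R : comPzRingType) (x b : R) (p h h' : nat -> R) :
  h' 0%N = h 0%N ->
  (forall k, h' k.+1 - x * h' k = h k.+1 - b * h k) ->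
  (forall k, k%:R * h k = newton_sum p h k) ->
  forall k, k%:R * h' k =
    newton_sum (fun i => p i + (x ^+ i - b ^+ i)) h' k.
Proof.
move=> h'0 hS hN k.
have -> : newton_sum (fun i => p i + (x ^+ i - b ^+ i)) h' k
  = newton_sum p h' k + newton_sum (GRing.exp x) h' k
    - newton_sum (GRing.exp b) h' k.
  rewrite /newton_sum -big_split -sumrB /=.
  by apply: eq_bigr => i _; ring.
elim: k => [|k IHk]; first by rewrite /newton_sum !big_ord0 mul0r addr0 subr0.
have hp := newton_sum_pair p h'0 hS k.
have hb := newton_sum_pair (GRing.exp b) h'0 hS k.
move: hp hb (hS k); rewrite !newton_sum_expr -!hN.
move=> /(canRL (subrK _)) -> hb /(canRL (subrK _)) ->.
(* The Newton sums of [h] with powers of [b] cancel, leaving only [b * h k]. *)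
have {}hb : b * h' k + b * newton_sum (GRing.exp b) h' k
   = b * h k + x * newton_sum (GRing.exp b) h' k.
  by move: hb => /(canRL (subrK _)) ->; ring.
rewrite hb -natr1.
have e : k%:R * h' k * x = (newton_sum p h' k + newton_sum (GRing.exp x) h' k -
           newton_sum (GRing.exp b) h' k) * x by rewrite IHk.
transitivity (k%:R * h' k * x + (x * h' k + (k%:R + 1) * (h k.+1 - b * h k))).
  by ring.
by rewrite e; ring.
Qed.

(** * Coefficients at infinity of rational functions *)

Section TopCoef.
Variable F : fieldType.
Implicit Types (P : {poly F}) (x b : nat -> F).

Definition node_poly x M : {poly F} := \prod_(r < M) ('X - (x r)%:P).

(* The coefficient of [u^-1] in the expansion at infinity of
   [P / node_poly x M]. *)
Definition top_coef x M P : F := (P %% node_poly x M)`_M.-1.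

Lemma node_polyS x M : node_poly x M.+1 = node_poly x M * ('X - (x M)%:P).
Proof. by rewrite /node_poly big_ord_recr. Qed.

Lemma size_node_poly x M : size (node_poly x M) = M.+1.
Proof. by rewrite size_prod_XsubC /index_enum -enumT size_enum_ord. Qed.

Lemma node_poly_monic x M : node_poly x M \is monic.
Proof. exact: monic_prod_XsubC. Qed.

Lemma top_coefD x M P Q : top_coef x M (P + Q) = top_coef x M P + top_coef x M Q.
Proof. by rewrite /top_coef modpD coefD. Qed.

Lemma top_coefZ x M c P : top_coef x M (c *: P) = c * top_coef x M P.
Proof. by rewrite /top_coef modpZl coefZ. Qed.

Lemma top_coef_sum x M I (r : seq I) (G : I -> {poly F}) :
  top_coef x M (\sum_(i <- r) G i) = \sum_(i <- r) top_coef x M (G i).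
Proof.
apply: (big_morph (top_coef x M)); first exact: top_coefD.
by rewrite /top_coef mod0p coef0.
Qed.

Lemma top_coef_small x M P : (size P <= M)%N -> top_coef x M P = P`_M.-1.
Proof. by move=> sP; rewrite /top_coef modp_small // size_node_poly ltnS. Qed.

(** A common linear factor cancels from the fraction. *)
Lemma top_coef_XsubC x M P :
  top_coef x M.+1 (P * ('X - (x M)%:P)) = top_coef x M P.
Proof.
rewrite /top_coef node_polyS.
set D := node_poly x M; set L := 'X - _.
have D0 : D != 0 by rewrite monic_neq0 // node_poly_monic.
have sR : (size (P %% D)%R <= M)%N.
  by rewrite -ltnS -(size_node_poly x M) ltn_modp.
have -> : P * L %% (D * L) = P %% D * L.
  rewrite {1}(divp_eq P D) mulrDl -mulrA modp_addl_mul_small //.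
  have L0 : L != 0 by rewrite polyXsubC_eq0.
  rewrite (size_mul D0) // size_node_poly.
  apply: leq_ltn_trans (size_polyMleq _ _) _; by rewrite size_XsubC !addn2 ltnS.
rewrite mulrBr coefB coefMX coefMC (nth_default 0 sR) mul0r subr0 /=.
(* For [M = 0] the truncated index reads a coefficient of a remainder modulo 1, which is zero. *)
by case: M @D L D0 sR => // D L D0 sR; rewrite (nth_default 0 sR).
Qed.

(** The coefficient of [u^-k] in [H(u) = prod (u - b_r) / (u - x_r)], read off [u^(k-1) H(u)]; for
    [k = 0] that power is not a polynomial. *)
Definition ratio_coef x b M k : F :=
  if k is k'.+1 then top_coef x M (node_poly b M * 'X^k') else 1.

(** Induction on [M]: one more node multiplies the series by [(u - b_M) / (u - x_M)], which is
    [newton_pair] with [t = 1/u]. *)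
Lemma ratio_coef_newton x b M k :
  k%:R * ratio_coef x b M k
  = newton_sum (fun i => \sum_(r < M) x r ^+ i - \sum_(r < M) b r ^+ i)
      (ratio_coef x b M) k.
Proof.
elim: M k => [|M IHM] k.
  rewrite /newton_sum big1 => [|i _]; last by rewrite !big_ord0 subrr mul0r.
  case: k => [|k]; rewrite ?mul0r //= /top_coef /node_poly !big_ord0.
  by rewrite modp1 coef0 mulr0.
rewrite (newton_pair (x := x M) (b := b M) (h := ratio_coef x b M) _ _ IHM) //.
  apply: eq_bigr => i _; congr (_ * _).
  by rewrite !big_ord_recr /=; ring.
case=> [|j] /=.
  rewrite !expr0 !mulr1 node_polyS.
  (* The first summand cancels the new node; the second gives [x M - b M] times a leading
     coefficient 1. *)
  have -> : 'X - (b M)%:P = 'X - (x M)%:P + (x M - b M)%:P :> {poly F}.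
    by rewrite polyCB; ring.
  rewrite mulrDr top_coefD top_coef_XsubC mulrC mul_polyC top_coefZ.
  rewrite (@top_coef_small x M.+1) ?size_node_poly //=.
  have := node_poly_monic b M; rewrite monicE lead_coefE size_node_poly /= => /eqP ->.
  by ring.
(* The difference of powers [u^(j+1) - x_M u^j] supplies the factor to cancel. *)
rewrite -!mulNr -!top_coefZ -!top_coefD.
rewrite -(top_coef_XsubC x M); congr top_coef.
by rewrite node_polyS -!mul_polyC !exprS !polyCN; ring.
Qed.

End TopCoef.

(** * Lagrange interpolation and evaluation of [h_{k;a}] *)

Section Lagrange.
Variables (F : fieldType) (x : nat -> F) (M : nat).
Hypothesis x_inj : injective x.

(** This is [1 / D'(x_r)] for [D = node_poly x M]. *)
Definition lagrange_weight (r : 'I_M) : F :=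
  (\prod_(s < M | s != r) (x r - x s))^-1.

Lemma lagrange_weight_neq0 r : lagrange_weight r != 0.
Proof.
rewrite invr_eq0; apply/prodf_neq0 => s sr.
by rewrite subr_eq0; apply: contraNneq sr => /x_inj /val_inj ->.
Qed.

(** The remainder has degree below [M], so it is its own interpolant at the nodes, and each [B r] is
    monic of degree [M - 1]. *)
Lemma top_coef_lagrange (P : {poly F}) :
  top_coef x M P = \sum_(r < M) P.[x r] * lagrange_weight r.
Proof.
rewrite /top_coef; set D := node_poly x M; set Q := P %% D.
pose B r := \prod_(s < M | s != r) ('X - (x s)%:P).
have sB r : size (B r) = M.
  have := size_node_poly x M; rewrite /node_poly (bigD1 r) //= -/(B r).
  rewrite size_mul ?polyXsubC_eq0 ?monic_neq0 ?monic_prod_XsubC //.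
  by rewrite size_XsubC addnC addn2 => -[].
have D0 : D != 0 by rewrite monic_neq0 // node_poly_monic.
have sQ : (size Q <= M)%N.
  by rewrite -ltnS -(size_node_poly x M) ltn_modp.
have Dx (r : 'I_M) : D.[x r] = 0.
  by rewrite horner_prod (bigD1 r) //= hornerXsubC subrr mul0r.
have Qx (r : 'I_M) : Q.[x r] = P.[x r].
  by rewrite [in RHS](divp_eq P D) hornerD hornerM Dx mulr0 add0r.
have Bx (r s : 'I_M) : (B r).[x s] = if s == r then (lagrange_weight r)^-1 else 0.
  rewrite horner_prod; case: eqP => [->|/eqP sr].
    by rewrite invrK; apply: eq_bigr => t _; rewrite hornerXsubC.
  by rewrite (bigD1 s) //= hornerXsubC subrr mul0r.
have QE : Q = \sum_(r < M) (P.[x r] * lagrange_weight r) *: B r.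
  apply/eqP; rewrite -subr_eq0; apply/eqP.
  apply: (@roots_geq_poly_eq0 _ _ [seq x i | i <- iota 0 M]); last first.
  - rewrite size_map size_iota; apply: leq_trans (size_polyD _ _) _.
    rewrite geq_max sQ size_polyN; apply: leq_trans (size_sum _ _ _) _.
    apply/bigmax_leqP => r _; apply: leq_trans (size_scale_leq _ _) _.
    by rewrite sB.
  - by rewrite map_inj_uniq // iota_uniq.
  apply/allP => y /mapP[i]; rewrite mem_iota /= add0n => iM ->.
  have [s ->] : exists s : 'I_M, i = s by exists (Ordinal iM).
  rewrite rootE hornerD hornerN horner_sum Qx (bigD1 s) //= big1 => [|r rs].
    by rewrite hornerZ Bx eqxx mulfK ?lagrange_weight_neq0 // addr0 subrr.
  by rewrite hornerZ Bx eq_sym (negPf rs) mulr0.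
rewrite QE coef_sum; apply: eq_bigr => r _; rewrite coefZ.
have : B r \is monic by apply: monic_prod_XsubC.
by rewrite monicE lead_coefE sB => /eqP ->; rewrite mulr1.
Qed.

End Lagrange.

(** * Products over consecutive indices and Vieta's formula *)

Section RootRun.
Variables (C : numClosedFieldType).
Implicit Type a : int -> C.

Definition root_run a (lo : int) (n : nat) : {poly C} :=
  node_poly (fun s => a (lo + s%:Z)) n.

Lemma root_runD a lo m n :
  root_run a lo (m + n) = root_run a lo m * root_run a (lo + m%:Z) n.
Proof.
rewrite /root_run /node_poly big_split_ord /=; congr (_ * _).
by apply: eq_bigr => i _; rewrite PoszD addrA.
Qed.

(** Writing the numerator of [H(u)] as a run allows it to be cut and glued with other runs. *)
Lemma root_run_rev a M :
  node_poly (fun r => a (- r%:Z)) M = root_run a (1 - M%:Z) M.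
Proof.
rewrite /root_run /node_poly (reindex_inj rev_ord_inj) /=.
apply: eq_bigr => i _; congr ('X - (a _)%:P); have := ltn_ord i; lia.
Qed.

Lemma meval_mesym n m (cs : n.-tuple C) :
  (mesym n C m).@[tnth cs] = elem m cs.
Proof.
case: cs => l sl; have e := eqP sl; subst n.
rewrite /elem /mesym raddf_sum /=.
apply: eq_bigr => s _; rewrite rmorph_prod /=; apply: eq_bigr => j _.
by rewrite mevalXU (tnth_nth 0).
Qed.

Lemma root_run_elem a (n : nat) (i : 'I_n.+1) :
  (root_run a 1 n)`_i
  = (-1) ^+ (n - i) * elem (n - i) [seq a j%:Z | j <- iota 1 n].
Proof.
set l := [seq _ | _ <- _].
have sl : size l == n by rewrite size_map size_iota.
have -> : root_run a 1 n = \prod_(c <- Tuple sl) ('X - c%:P).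
  rewrite /= /l big_map -[1%N]addn0 iotaDl big_map /root_run /node_poly.
  rewrite -[n in iota 0 n]subn0 big_mkord.
  by apply: eq_bigr => s _; rewrite PoszD.
have h : (n - i < n.+1)%N by lia.
have := mroots_coeff (Tuple sl) (Ordinal h).
rewrite /= subKn => [->|]; last by have := ltn_ord i; lia.
by rewrite meval_mesym.
Qed.

End RootRun.

Section Evaluation.
Variables (C : numClosedFieldType) (N : nat) (x b : nat -> C) (M : nat).
Variable v : 'I_N -> C.
Hypothesis vE : forall i : 'I_N,
  v i = \sum_(r < M) x r ^+ i.+1 - \sum_(r < M) b r ^+ i.+1.

Lemma size_hlist k : size (hlist C N k) = k.+1.
Proof. by elim: k => //= k IHk; rewrite size_rcons IHk. Qed.

Lemma nth_hlist k j : (j <= k)%N -> nth 0 (hlist C N k) j = hcomp C N j.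
Proof.
elim: k => [|k IHk] jk; first by case: j jk.
have [->//|jk'] := eqVneq j k.+1.
have {jk jk'} jk : (j <= k)%N by lia.
by rewrite /= nth_rcons size_hlist ltnS jk IHk.
Qed.

Lemma hcompS k :
  hcomp C N k.+1
  = k.+1%:R^-1 *: \sum_(i < k.+1) psum C N i.+1 * hcomp C N (k - i).
Proof.
rewrite /hcomp /= nth_rcons size_hlist ltnn eqxx; congr (_ *: _).
by apply: eq_bigr => i _; rewrite nth_hlist //; lia.
Qed.

Lemma meval_psum i : (i < N)%N ->
  (psum C N i.+1).@[v] = \sum_(r < M) x r ^+ i.+1 - \sum_(r < M) b r ^+ i.+1.
Proof. by move=> iN; rewrite /psum insubT mevalXU vE. Qed.

(** Both sides satisfy Newton's identities, which determine them in characteristic zero; [k <= N]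
    keeps the power sums inside the model. *)
Lemma meval_hcomp k : (k <= N)%N -> (hcomp C N k).@[v] = ratio_coef x b M k.
Proof.
elim/ltn_ind: k => -[|k] IHk kN; first by rewrite /hcomp /= meval1.
rewrite hcompS mevalZ; apply: (mulfI (x := k.+1%:R)); first by rewrite pnatr_eq0.
rewrite mulVKf ?pnatr_eq0 // ratio_coef_newton /newton_sum raddf_sum /=.
apply: eq_bigr => i _; have := ltn_ord i => ik.
by rewrite mevalM meval_psum ?IHk //; lia.
Qed.

(** By Vieta the weights in [hfa] are the coefficients of [root_run a 1 k], and [hcomp i.+1] is read
    off [u^i H(u)]. *)
Lemma meval_hfa a k : (k < N)%N ->
  (hfa N (Posz k.+1) a).@[v] = top_coef x M (node_poly b M * root_run a 1 k).
Proof.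
move=> kN; rewrite /hfa raddf_sum /=.
have -> : root_run a 1 k = \sum_(i < k.+1) (root_run a 1 k)`_i *: 'X^i.
  rewrite -poly_def.
  by rewrite -[X in \poly_(i < X) _](size_node_poly (fun s => a (1 + s%:Z))) coefK.
rewrite mulr_sumr top_coef_sum; apply: eq_bigr => i _.
rewrite mevalZ meval_hcomp; last by have := ltn_ord i; lia.
by rewrite -scalerAr top_coefZ root_run_elem.
Qed.

End Evaluation.

(** * Factorization of the determinant *)

(** The first [k + 1] rows of [A] live on [k] columns, so a nonzero combination of them vanishes,
    and it also kills [A *m B]. *)
Lemma det_mulmx_zero_block (F : fieldType) (d M k : nat)
    (A : 'M[F]_(d, M)) (B : 'M[F]_(M, d)) :
  (k < d)%N -> (forall (i : 'I_d) (r : 'I_M), (i <= k <= r)%N -> A i r = 0) ->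
  \det (A *m B) = 0.
Proof.
move=> kd A0; pose f := widen_ord kd.
(* [insub] pads with zero columns in case [k] exceeds [M]. *)
pose X := \matrix_(s < k.+1, c < k)
  (if insub (val c) is Some r then A (f s) r else 0).
have : kermx X != 0.
  by rewrite kermx_eq0 /row_free neq_ltn ltnS rank_leq_col.
rewrite -nz_row_eq0; set u := nz_row _ => u0.
have uX : u *m X = 0 by apply/sub_kermxP/nz_row_sub.
apply/eqP/det0P; exists (u *m rowsub f 1%:M).
  apply: contraNneq u0 => /rowP uf0; apply/eqP/rowP => s.
  have := uf0 (f s); rewrite mxE (bigD1 s) //= big1 => [|t ts].
    by rewrite !mxE eqxx mulr1 addr0.
  have fts : f t != f s by [].
  by rewrite !mxE (negPf fts) mulr0.
rewrite mulmxA -[u *m _ *m A]mulmxA mul_rowsub_mx mul1mx.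
suff -> : u *m rowsub f A = 0 by rewrite mul0mx.
apply/rowP => r; rewrite mxE [RHS]mxE.
case: (ltnP r k) => rk.
  transitivity ((u *m X) 0 (Ordinal rk)); last by rewrite uX mxE.
  rewrite [RHS]mxE.
  by apply: eq_bigr => s _; rewrite !mxE -[val (Ordinal rk)]/(val r) valK.
by apply: big1 => s _; rewrite mxE A0 ?mulr0 //= rk andbT -ltnS.
Qed.

Lemma nth_sorted_geq (s : seq nat) i j :
  sorted geq s -> (i <= j)%N -> (nth 0 s j <= nth 0 s i)%N.
Proof.
move=> /(sortedP 0%N) hs; elim: j => [|j IHj]; first by case: i.
rewrite leq_eqVlt => /orP[/eqP -> //|/IHj]; apply: leq_trans.
by have [/hs|js] := ltnP j.+1 (size s); rewrite // nth_default.
Qed.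

Section Determinant.
Variables (C : numClosedFieldType) (a : int -> C) (N M : nat).
Variables (lam mu : seq nat).
Hypothesis a_inj : injective a.
Hypothesis lam_sorted : sorted geq lam.

Definition lam_node (r : nat) : C := a ((nth 0%N lam r)%:Z - r%:Z).
Definition empty_node (r : nat) : C := a (- r%:Z).

(** The indices [lam_r - r] strictly decrease, also past the length, where [lam_r] defaults to 0. *)
Lemma lam_node_inj : injective lam_node.
Proof.
move=> r s /a_inj; wlog rs : r s / (r <= s)%N => [H|].
  by case/orP: (leq_total r s) => /H // + /esym => {}H /H.
by have := nth_sorted_geq lam_sorted rs; lia.
Qed.

Variable v : 'I_N -> C.
Hypothesis vE : forall i : 'I_N,
  v i = \sum_(r < M) lam_node r ^+ i.+1 - \sum_(r < M) empty_node r ^+ i.+1.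

(** The polynomial [A_i]; its length is [(mu_i - i) - (1 - M)], without truncation when [i < M]. *)
Definition row_poly (i : nat) : {poly C} :=
  root_run a (1 - M%:Z) (M + nth 0%N mu i - i.+1).
Definition col_poly (j : nat) : {poly C} := root_run a (1 - j%:Z) j.

Lemma size_row_col_poly i j :
  size (row_poly i * col_poly j) = (M + nth 0%N mu i - i.+1 + j).+1.
Proof.
rewrite size_mul ?monic_neq0 ?node_poly_monic // !size_node_poly; lia.
Qed.

Lemma meval_hfa_entry i j : (i < M)%N -> (j < M)%N -> (nth 0 mu i + j <= N)%N ->
  (hfa N ((nth 0%N mu i)%:Z - i%:Z + j%:Z) (tau (- j%:Z) a)).@[v]
  = top_coef lam_node M (row_poly i * col_poly j).
Proof.
move=> iM jM hN; have sP := size_row_col_poly i j.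
case: (ltngtP (nth 0%N mu i + j) i) => h.
(* Negative index: the product has degree below [M - 1]. *)
- have -> : (nth 0%N mu i)%:Z - i%:Z + j%:Z = Negz (i - (nth 0%N mu i + j)).-1.
    by lia.
  have sP1 : (size (row_poly i * col_poly j)%R <= M.-1)%N by rewrite sP; lia.
  rewrite /= meval0 top_coef_small; last by apply: leq_trans sP1 (leq_pred M).
  by rewrite nth_default.
- have [k hk] : exists k, (nth 0%N mu i + j = i + k.+1)%N.
    by exists (nth 0%N mu i + j - i).-1; lia.
  have -> : (nth 0%N mu i)%:Z - i%:Z + j%:Z = Posz k.+1 by lia.
  rewrite (meval_hfa vE); last by lia.
  (* The numerator is cut before index [1 - j]; its lower piece continues into the shifted run to
     form [A_i], and its upper piece is [B_j]. *)
  congr top_coef; rewrite root_run_rev.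
  have -> : root_run (tau (- j%:Z) a) 1 k = root_run a (1 - j%:Z) k.
    apply: eq_bigr => s _; rewrite /tau; congr ('X - (a _)%:P); lia.
  rewrite /row_poly /col_poly.
  have -> : (M + nth 0%N mu i - i.+1 = (M - j) + k)%N by lia.
  have -> : root_run a (1 - M%:Z) M
    = root_run a (1 - M%:Z) (M - j) * root_run a (1 - j%:Z) j.
    rewrite -[X in root_run _ _ X = _](subnK (ltnW jM)) root_runD.
    congr (_ * root_run _ _ _); lia.
  rewrite root_runD mulrAC; congr (_ * root_run _ _ _ * _); lia.
(* Index zero: the product is monic of degree exactly [M - 1]. *)
- have -> : (nth 0%N mu i)%:Z - i%:Z + j%:Z = Posz 0 by lia.
  rewrite /= meval1 top_coef_small ?sP; last by lia.
  have : row_poly i * col_poly j \is monic by rewrite monicMl node_poly_monic.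
  rewrite monicE lead_coefE sP => /eqP <-; congr (_`_ _); lia.
Qed.

Definition row_mx_poly : 'M[C]_(size mu, M) :=
  \matrix_(i, r) (row_poly i).[lam_node r].
Definition col_mx_poly d : 'M[C]_(M, d) :=
  \matrix_(r, j) (lagrange_weight lam_node r * (col_poly j).[lam_node r]).

Lemma meval_sfa : (size mu <= M)%N ->
  (forall i j, i < size mu -> j < size mu -> nth 0 mu i + j <= N)%N ->
  (sfa N a mu).@[v] = \det (row_mx_poly *m col_mx_poly (size mu)).
Proof.
move=> sM hN; rewrite /sfa -det_map_mx; congr (\det _).
apply/matrixP => i j; rewrite !mxE /= meval_hfa_entry ?hN //.
- rewrite (top_coef_lagrange M lam_node_inj); apply: eq_bigr => r _.
  by rewrite !mxE hornerM mulrA mulrAC.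
- exact: leq_trans (ltn_ord i) sM.
- exact: leq_trans (ltn_ord j) sM.
Qed.

(** The index [lam_r - r] falls within the run: it is at least [1 - M] because [r < M], and it is
    below [mu_i - i]. *)
Lemma row_poly_eq0 i (r : 'I_M) : (i < M)%N ->
  (nth 0 lam r + i < nth 0 mu i + r)%N -> (row_poly i).[lam_node r] = 0.
Proof.
move=> iM h; rewrite horner_prod; have rM := ltn_ord r.
have hs : (nth 0 lam r + M - r.+1 < M + nth 0 mu i - i.+1)%N by lia.
rewrite (bigD1 (Ordinal hs)) //= hornerXsubC /lam_node.
have -> : 1 - M%:Z + (nth 0 lam r + M - r.+1)%N%:Z = (nth 0%N lam r)%:Z - r%:Z.
  by lia.
by rewrite subrr mul0r.
Qed.

Lemma meval_sfa_eq0 : sorted geq mu -> (size mu <= M)%N ->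
  (forall i j, i < size mu -> j < size mu -> nth 0 mu i + j <= N)%N ->
  ~~ subdiag mu lam -> (sfa N a mu).@[v] = 0.
Proof.
move=> mu_sorted sM hN /allPn[k]; rewrite mem_iota /= add0n -ltnNge => kmu hk.
rewrite meval_sfa //; apply: (det_mulmx_zero_block _ kmu) => i r /andP[ik kr].
rewrite mxE row_poly_eq0 //; first exact: leq_trans (ltn_ord i) sM.
(* For [i <= k <= r]: [lam_r - r <= lam_k - k < mu_k - k <= mu_i - i]. *)
have := nth_sorted_geq mu_sorted ik; have := nth_sorted_geq lam_sorted kr; lia.
Qed.

End Determinant.

(** Each [col_poly a j] is monic of degree [j], so the matrix is diagonal times Vandermonde times
    unitriangular. *)
Lemma det_col_mx_poly (C : numClosedFieldType) (a : int -> C) M lam :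
  injective a -> sorted geq lam -> \det (@col_mx_poly C a M lam M) != 0.
Proof.
move=> a_inj lam_sorted; have x_inj := lam_node_inj a_inj lam_sorted.
pose w := \row_(r < M) lagrange_weight (lam_node a lam) r.
pose x := \row_(r < M) lam_node a lam r.
pose T := \matrix_(k < M, j < M) (col_poly a j)`_k.
have -> : col_mx_poly a M lam M = diag_mx w *m ((Vandermonde M x)^T *m T).
  apply/matrixP => r j; rewrite mul_diag_mx !mxE; congr (_ * _).
  rewrite (@horner_coef_wide _ M); last by rewrite size_node_poly.
  by apply: eq_bigr => k _; rewrite !mxE mulrC.
rewrite !det_mulmx det_diag det_tr det_Vandermonde -(det_tr T).
rewrite (det_trig (A := T^T)); last first.
  apply/is_trig_mxP => i j ij; rewrite !mxE nth_default // size_node_poly.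
  exact: ij.
rewrite !mulf_neq0 //; apply/prodf_neq0 => i _.
- by rewrite mxE lagrange_weight_neq0.
- apply/prodf_neq0 => j ij; rewrite !mxE subr_eq0.
  by apply: contraTneq ij => /x_inj ->; rewrite ltnn.
- have := node_poly_monic (fun s => a (1 - i%:Z + s%:Z)) i.
  by rewrite monicE lead_coefE size_node_poly !mxE => /eqP ->; rewrite oner_eq0.
Qed.

(** Taking [M = size lam] makes both factors square, and the left one is lower triangular. *)
Lemma meval_sfa_neq0 (C : numClosedFieldType) (a : int -> C) N lam (v : 'I_N -> C) :
  injective a -> sorted geq lam ->
  (forall i, v i = \sum_(r < size lam) lam_node a lam r ^+ i.+1
                   - \sum_(r < size lam) empty_node a r ^+ i.+1) ->
  (forall i j, i < size lam -> j < size lam -> nth 0 lam i + j <= N)%N ->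
  (sfa N a lam).@[v] != 0.
Proof.
move=> a_inj lam_sorted vE hN.
rewrite (meval_sfa a_inj lam_sorted vE) // det_mulmx mulf_neq0 ?det_col_mx_poly //.
rewrite det_trig; last first.
  apply/is_trig_mxP => i j ij; rewrite mxE row_poly_eq0 //.
  have := nth_sorted_geq lam_sorted (ltnW ij); lia.
(* On the diagonal, the roots of [row_poly] have indices strictly below [lam_i - i]. *)
apply/prodf_neq0 => i _; rewrite mxE horner_prod; apply/prodf_neq0 => s _.
rewrite hornerXsubC subr_eq0; apply/negP => /eqP/a_inj.
have := ltn_ord s; have := ltn_ord i; lia.
Qed.

(** * Frobenius coordinates *)

Section Frobenius.
Local Open Scope nat_scope.

(** A downward closed predicate holds on an initial segment, whose length is the count. *)
Lemma ltn_count_initial (P : pred nat) n i :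
  (forall j, P j.+1 -> P j) -> (i < count P (iota 0 n)) = (i < n) && P i.
Proof.
move=> Pdown; have Ple j k : j <= k -> P k -> P j.
  elim: k => [|k IHk]; first by case: j.
  by rewrite leq_eqVlt => /orP[/eqP -> //|/IHk Pk /Pdown].
elim: n i => [|n IHn] i; first by rewrite ltn0.
rewrite -[n.+1]addn1 iotaD count_cat /= add0n addn0 addn1.
case: (boolP (P n)) => Pn /=.
  have -> : count P (iota 0 n) = n.
    rewrite (@eq_in_count _ _ predT) ?count_predT ?size_iota // => j.
    by rewrite mem_iota add0n => /ltnW jn; rewrite (Ple j n).
  rewrite addn1; case: (ltnP i n.+1) => //= i_n.
  by rewrite (Ple i n).
rewrite addn0 IHn; have [->|i_n] := eqVneq i n; first by rewrite (negPf Pn) !andbF.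
by rewrite ltnS [i <= n]leq_eqVlt (negPf i_n).
Qed.

Variables (lam : seq nat) (lam_sorted : sorted geq lam).

Lemma ltn_size_nth i r : i < nth 0 lam r -> r < size lam.
Proof. by case: (ltnP r (size lam)) => // rl; rewrite nth_default. Qed.

Lemma ltn_dlen i : (i < dlen lam) = (i < nth 0 lam i).
Proof.
rewrite /dlen size_filter ltn_count_initial => [|j jl].
  by apply: andb_idl; apply: ltn_size_nth.
by have := nth_sorted_geq lam_sorted (leqnSn j); lia.
Qed.

Lemma ltn_conjp i r : (r < conjp lam i) = (i < nth 0 lam r).
Proof.
rewrite /conjp -{1}(mkseq_nth 0 lam) /mkseq count_map.
rewrite ltn_count_initial => [|j /=].
  by apply: andb_idl; apply: ltn_size_nth.
by have := nth_sorted_geq lam_sorted (leqnSn j); lia.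
Qed.

Lemma dlen_le_size : dlen lam <= size lam.
Proof. by rewrite /dlen size_filter -[leqRHS](size_iota 0) count_size. Qed.

Lemma conjp_le i j : i <= j -> conjp lam j <= conjp lam i.
Proof.
by move=> ij; apply: sub_count => k; apply: leq_ltn_trans.
Qed.

(* [{lam_r - r}] and [{0, -1, -2, ...}] differ exactly by the Frobenius
   coordinates. *)
Lemma frobenius_perm M : size lam <= M ->
  perm_eq ([seq conjp lam i - i.+1 | i <- iota 0 (dlen lam)]
           ++ [seq r - nth 0 lam r | r <- iota (dlen lam) (M - dlen lam)])
          (iota 0 M).
Proof.
move=> sM; have dM := leq_trans dlen_le_size sM.
have cle i : conjp lam i <= size lam by apply: count_size.
have cgt i : i < dlen lam -> i < conjp lam i by rewrite ltn_conjp ltn_dlen.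
have lle r : dlen lam <= r -> nth 0 lam r <= r by rewrite leqNgt ltn_dlen -leqNgt.
set s := _ ++ _.
have ss : size s = M by rewrite size_cat !size_map !size_iota; lia.
have us : uniq s.
  rewrite cat_uniq !map_inj_in_uniq ?iota_uniq ?andbT /=.
  - apply/hasPn => y /mapP[r]; rewrite mem_iota => /andP[dr rM] ->.
    apply/mapP => -[i]; rewrite mem_iota /= add0n => id e.
    (* Equality would mean [lam_r + lam'_i = r + i + 1], but the sum is at least [r + i + 2] if
       [i < lam_r] and at most [r + i] otherwise. *)
    have := cgt _ id; have := lle _ dr; have := ltn_conjp i r; lia.
  - move=> r r'; rewrite !mem_iota => /andP[dr _] /andP[dr' _].
    wlog rr : r r' dr dr' / r <= r' => [H|].
      move=> e; case/orP: (leq_total r r') => rr; first exact: H.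
      exact/esym/H.
    have := lle _ dr; have := lle _ dr'; have := nth_sorted_geq lam_sorted rr; lia.
  - move=> i j; rewrite !mem_iota /= !add0n => di dj.
    wlog ij : i j di dj / i <= j => [H|].
      move=> e; case/orP: (leq_total i j) => ij; first exact: H.
      exact/esym/H.
    have := cgt _ di; have := cgt _ dj; have := conjp_le ij; lia.
apply: uniq_perm => //; first exact: iota_uniq.
(* A duplicate-free list of [M] numbers below [M] exhausts them. *)
apply: (uniq_min_size us _ _).2; last by rewrite ss size_iota.
move=> k; rewrite mem_cat mem_iota add0n /= => /orP[] /mapP[i].
  by rewrite mem_iota /= add0n => /cgt h ->; have := cle i; lia.
by rewrite mem_iota => h ->; lia.
Qed.

End Frobenius.

Lemma frobenius_psum (C : numClosedFieldType) (a : int -> C) lam M i :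
  sorted geq lam -> (size lam <= M)%N ->
  \sum_(x <- xlam a lam) x ^+ i.+1 + (-1) ^+ i * \sum_(y <- ylam a lam) y ^+ i.+1
  = \sum_(r < M) lam_node a lam r ^+ i.+1 - \sum_(r < M) empty_node a r ^+ i.+1.
Proof.
move=> lam_sorted sM; rewrite /xlam /ylam !big_map mulr_sumr.
have dM := leq_trans (dlen_le_size lam) sM.
pose P z := a z ^+ i.+1.
have -> : \sum_(r < M) lam_node a lam r ^+ i.+1
  = \sum_(r <- iota 0 M) P ((nth 0%N lam r)%:Z - r%:Z).
  by rewrite -[M in iota 0 M]subn0 big_mkord.
have -> : \sum_(r < M) empty_node a r ^+ i.+1
  = \sum_(r <- iota 0 M) P (- r%:Z).
  by rewrite -[M in iota 0 M]subn0 big_mkord.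
rewrite -[X in _ - X](perm_big _ (frobenius_perm lam_sorted sM)) /=.
rewrite [X in _ - X]big_cat /= !big_map.
have -> : iota 0 M = iota 0 (dlen lam) ++ iota (dlen lam) (M - dlen lam).
  by rewrite -[M in LHS](subnKC dM) iotaD.
rewrite big_cat /=.
(* Rows below the diagonal part contribute equally to both sums and cancel. *)
rewrite [X in _ = _ + X - _](_ : _ =
  \sum_(r <- iota (dlen lam) (M - dlen lam)) P (- (r - nth 0%N lam r)%N%:Z)); last first.
  apply: eq_big_seq => r; rewrite mem_iota => /andP[dr _]; congr P.
  by have := ltn_dlen lam_sorted r; lia.
rewrite opprD addrACA subrr addr0; congr (_ + _).
  apply: eq_bigr => r _; rewrite -[lam`_r]/(nth 0%N lam r).
  by congr (a _ ^+ _); lia.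
rewrite -sumrN; apply: eq_big_seq => r; rewrite mem_iota /= add0n => rd.
have cr : (r < conjp lam r)%N by rewrite ltn_conjp // -ltn_dlen.
(* The dual entry is [-a_{-q}], and the signs [(-1)^i] and [(-1)^(i+1)] combine to [-1]. *)
rewrite /dual (exprNn (a _)) mulrA -exprD addnS exprS exprD -expr2 sqrr_sign.
by rewrite mulr1 mulN1r; congr (- (a _ ^+ _)); lia.
Qed.

(** * Expansion over partitions *)

Section Partitions.
Local Open Scope nat_scope.

Lemma size_le_sumn (s : seq nat) : all (ltn 0) s -> size s <= sumn s.
Proof. by elim: s => //= k s IHs /andP[k0 /IHs]; lia. Qed.

(** A hook of the diagram has at most [sumn s] boxes; this keeps every index in the determinant at
    most [N]. *)
Lemma nth_add_size_le_sumn (s : seq nat) i : all (ltn 0) s -> i < size s ->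
  nth 0 s i + (size s).-1 <= sumn s.
Proof.
elim: s i => //= k s IHs [|i] /andP[k0 s0] /=.
  by have := size_le_sumn s0; lia.
by rewrite ltnS => si; have := IHs i s0 si; lia.
Qed.

(** Only trailing zeros are removed, so [tpart] loses nothing once the length is fixed. *)
Lemma sorted_geq_filter (s : seq nat) : sorted geq s ->
  s = [seq k <- s | 0 < k] ++ nseq (size s - size [seq k <- s | 0 < k]) 0.
Proof.
elim: s => //= k s IHs ks; have s_sorted := path_sorted ks.
case: posnP => [k0|k0] /=; last by rewrite subSS -IHs.
have s0 : all (pred1 0) s.
  apply/allP => j js /=; rewrite k0 in ks.
  have /allP/(_ j js) /= := order_path_min (fun y x z yx zy => leq_trans zy yx) ks.
  by rewrite leqn0.
have -> : [seq k <- s | 0 < k] = [::].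
  by rewrite -(filter_pred0 s); apply: eq_in_filter => j /(allP s0) /eqP ->.
by rewrite k0 subn0 /=; congr (_ :: _); apply/all_pred1P.
Qed.

Variable n : nat.
Implicit Types (t : n.-tuple 'I_n.+1) (lam : seq nat).

Lemma tpart_is_part t : part_tuple t -> is_part (tpart t).
Proof.
case/andP=> st _; rewrite /is_part filter_all andbT.
by apply: sorted_filter st => y x z yx zy; apply: leq_trans zy yx.
Qed.

Lemma sumn_tpart t : part_tuple t -> sumn (tpart t) <= n.
Proof.
case/andP=> /sorted_geq_filter ->.
by rewrite sumn_cat sumn_nseq mul0n addn0.
Qed.

Lemma tpart_inj : {in @part_tuple n &, injective (@tpart n)}.
Proof.
move=> t t' /andP[st _] /andP[st' _] e.
apply/val_inj/(inj_map val_inj) => /=.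
rewrite (sorted_geq_filter st) (sorted_geq_filter st').
by rewrite -/(tpart t) -/(tpart t') e !size_map !size_tuple.
Qed.

Lemma tpart_surj lam : is_part lam -> sumn lam <= n ->
  exists2 t : n.-tuple 'I_n.+1, part_tuple t & tpart t = lam.
Proof.
case/andP=> lam_sorted lam0 ln; have sl := leq_trans (size_le_sumn lam0) ln.
have le i : nth 0 lam i <= n.
  have [il|il] := ltnP i (size lam); last by rewrite nth_default.
  by have := nth_add_size_le_sumn lam0 il; lia.
(* Reading past the end of [lam] pads with zeros; [le] makes [inord] faithful. *)
pose t := [tuple of [seq inord (nth 0 lam i) | i <- iota_tuple n 0]] : n.-tuple 'I_n.+1.
have vt : map val t = lam ++ nseq (n - size lam) 0.
  rewrite /= -map_comp (eq_map (g := nth 0 lam)) => [|i];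
    last by rewrite /= inordK ?ltnS ?le.
  apply: (@eq_from_nth _ 0); rewrite size_map size_iota.
    by rewrite size_cat size_nseq subnKC.
  move=> i i_n; rewrite (nth_map 0) ?size_iota // nth_iota // nth_cat nth_nseq.
  by case: ltnP => // il; rewrite if_same nth_default.
exists t; last first.
  rewrite /tpart vt filter_cat filter_nseq /= cats0; exact/all_filterP.
rewrite /part_tuple {2}vt sumn_cat sumn_nseq mul0n addn0 ln andbT /=.
rewrite -map_comp (eq_map (g := nth 0 lam)) => [|i];
    last by rewrite /= inordK ?ltnS ?le.
apply/(sortedP 0) => i; rewrite size_map size_iota => i_n.
rewrite !(nth_map 0) ?size_iota ?nth_iota //; try lia.
exact: nth_sorted_geq (leqnSn _).
Qed.

End Partitions.

Section IsolateTerm.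
Variables (C : numClosedFieldType) (n : nat) (c e : seq nat -> C) (lam : seq nat).
Hypotheses (lam_part : is_part lam) (lam_n : (psize lam <= n)%N).

Lemma sum_tpart_isolate :
  (forall mu, is_part mu -> (psize mu <= n)%N -> ~~ subdiag mu lam -> e mu = 0) ->
  \sum_(t : n.-tuple 'I_n.+1 | part_tuple t) c (tpart t) * e (tpart t)
  = c lam * e lam
    + \sum_(t : n.-tuple 'I_n.+1 | part_tuple t && subdiag (tpart t) lam
                                   && (tpart t != lam))
        c (tpart t) * e (tpart t).
Proof.
move=> e0; have [t0 pt0 t0E] := tpart_surj lam_part lam_n.
rewrite (bigD1 t0) //= t0E; congr (_ + _).
rewrite (bigID (fun t => subdiag (tpart t) lam)) /=.
rewrite [X in _ + X]big1 ?addr0 => [|t /andP[/andP[pt _] nsub]]; last first.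
  by rewrite e0 ?mulr0 ?tpart_is_part ?sumn_tpart.
apply: eq_bigl => t; rewrite -t0E andbAC; case: (boolP (part_tuple t)) => //= pt.
by congr (_ && ~~ _); rewrite (inj_in_eq (@tpart_inj n)).
Qed.

End IsolateTerm.

(** The first row of the determinant vanishes: its indices are positive, and [h_{k;a}] with [k > 0]
    has no constant term. *)
Lemma sfa_origin (C : numClosedFieldType) (a : int -> C) N mu (v : 'I_N -> C) :
  is_part mu -> mu != [::] -> (psize mu <= N)%N -> (forall i, v i = 0) ->
  (sfa N a mu).@[v] = 0.
Proof.
case/andP=> _ mu0 mun smu v0; rewrite /sfa -det_map_mx.
have smu0 : (0 < size mu)%N by rewrite lt0n size_eq0.
have m0 : (0 < nth 0 mu 0)%N by move: mu0 mun; case: (mu) => //= k s /andP[].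
have hN := nth_add_size_le_sumn mu0 smu0.
rewrite (expand_det_row _ (Ordinal smu0)) big1 // => j _; have jm := ltn_ord j.
suff h0 : (hfa N ((nth 0%N mu 0%N)%:Z - Posz 0 + j%:Z) (tau (- j%:Z) a)).@[v] = 0.
  by rewrite !mxE; apply: etrans (mul0r _); congr (_ * _); exact: h0.
have -> : (nth 0%N mu 0%N)%:Z - Posz 0 + j%:Z = Posz (nth 0%N mu 0%N + j).-1.+1.
  by lia.
(* The origin is the case [M = 0], where [H(u) = 1]. *)
rewrite (@meval_hfa _ _ (fun=> 0) (fun=> 0) 0); last by lia.
  by rewrite /top_coef /node_poly !big_ord0 modp1 coef0.
by move=> i; rewrite v0 !big_ord0 subrr.
Qed.

Theorem theorem12 (C : numClosedFieldType) (a : int -> C) (Ha : injective a)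
  (N n : nat) (HnN : (n <= N)%N) (f : Lam C N) (Hf : deg_le n f)
  (c : seq nat -> C)
  (Hc : f = \sum_(t : n.-tuple 'I_n.+1 | part_tuple t)
               c (tpart t) *: sfa N a (tpart t)) :
  c [::] = ev f [:: 0] [:: 0] /\
  forall lam : seq nat, is_part lam -> lam != [::] -> (psize lam <= n)%N ->
    ev (sfa N a lam) (xlam a lam) (ylam a lam) != 0 /\
    c lam = (ev f (xlam a lam) (ylam a lam)
             - \sum_(t : n.-tuple 'I_n.+1 | part_tuple t && subdiag (tpart t) lam
                                           && (tpart t != lam))
                 c (tpart t) * ev (sfa N a (tpart t)) (xlam a lam) (ylam a lam))
            / ev (sfa N a lam) (xlam a lam) (ylam a lam).
Proof.
have evf xs ys : ev f xs ys = \sum_(t : n.-tuple 'I_n.+1 | part_tuple t)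
    c (tpart t) * ev (sfa N a (tpart t)) xs ys.
  by rewrite /ev Hc raddf_sum; apply: eq_bigr => t _; rewrite /= mevalZ.
split.
  rewrite evf.
  have sub0 mu : subdiag mu [::] -> all (ltn 0)%N mu -> mu = [::].
    by case: mu => //= k s /andP[/= + _] /andP[]; lia.
  have e0 mu : is_part mu -> mu != [::] -> (psize mu <= n)%N ->
      ev (sfa N a mu) [:: 0] [:: 0] = 0.
    move=> pmu mu0 smu; apply: sfa_origin => //; first exact: leq_trans HnN.
    by move=> i; rewrite !big_seq1 expr0n /= mulr0 addr0.
  rewrite (@sum_tpart_isolate _ n c (fun mu => ev (sfa N a mu) _ _) [::]) //.
    (* No diagram other than the empty one is contained in it, so the remaining sum has no terms. *)
    rewrite big1 => [|t /andP[/andP[pt sub] /eqP[]]]; last first.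
      by apply: sub0 sub _; case/andP: (tpart_is_part pt).
    by rewrite /ev /sfa det_mx00 meval1 mulr1 addr0.
  by move=> mu pmu smu nsub; apply: e0 => //; apply: contraNneq nsub => ->.
move=> lam plam lam0 slam; have /andP[lam_sorted lam_pos] := plam.
have hook mu : is_part mu -> (psize mu <= n)%N ->
    forall i j, (i < size mu -> j < size mu -> nth 0 mu i + j <= N)%N.
  move=> /andP[_ mu0] smu i j im jm.
  by have := nth_add_size_le_sumn mu0 im; lia.
have vE M (sM : (size lam <= M)%N) (i : 'I_N) :=
  frobenius_psum a i lam_sorted sM.
have nz : ev (sfa N a lam) (xlam a lam) (ylam a lam) != 0.
  by apply: meval_sfa_neq0 (hook _ plam slam) => // i; rewrite (vE (size lam)).
split=> //; rewrite evf.
rewrite (@sum_tpart_isolate _ n c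
  (fun mu => ev (sfa N a mu) (xlam a lam) (ylam a lam)) lam) //.
  by rewrite addrK mulfK.
move=> mu pmu smu nsub; have /andP[mu_sorted _] := pmu.
(* [M] must bound both lengths; the evaluation point does not depend on it. *)
apply: (meval_sfa_eq0 (M := maxn (size lam) (size mu)) (lam := lam)) => //.
- by move=> i; apply: vE; apply: leq_maxl.
- exact: leq_maxr.
exact: hook.
Qed.
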